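(* Let $X$ and $Y$ be non-negative absolutely continuous random variables with probability density functions $f$ and $g$, respectively, let $\omega\ge0$ be a weight function, $\alpha>0$ and $\beta\ge1$. Let $X_{e,\alpha}^*$ be the generalized escort random variable of order $\alpha$, and let $X_{e,\beta}$, $Y_{e,\beta}$ be the escort random variables of order $\beta$ with baseline densities $f$ and $g$. Then $$I_\beta^\omega(X_{e,\alpha}^* )=\frac{[I_\beta(X)]^\alpha[I_\beta(Y)]^{1-\alpha}}{[R_\alpha(X,Y)]^\beta}\,R_\alpha^\omega(X_{e,\beta},Y_{e,\beta}).$$
   Context: For a non-negative absolutely continuous random variable $X$ with density $f$, a measurable weight $\omega\ge0$ and $\beta\ge1$: $I_\beta^\omega(X)=\int_0^\infty\omega(u)f^\beta(u)\,du$ and $I_\beta(X)=\int_0^\infty f^\beta(u)\,du$. For $X,Y$ with densities $f,g$ and order $\alpha>0$: $R_\alpha^\omega(X,Y)=\int_0^\infty\omega(x)f^\alpha(x)g^{1-\alpha}(x)\,dx$ and $R_\alpha(X,Y)=\int_0^\infty f^\alpha(x)g^{1-\alpha}(x)\,dx$. The escort random variable $X_{e,\beta}$ of order $\beta$ with baseline density $f$ has density $f_{e,\beta}(u)=f^\beta(u)/\int_0^\infty f^\beta(v)\,dv$, $u>0$ (similarly $Y_{e,\beta}$ with $g$). The generalized escort random variable $X_{e,\alpha}^*$ of order $\alpha>0$ has density $f_{e,\alpha}^*(x)=\dfrac{f^\alpha(x)g^{1-\alpha}(x)}{\int_0^\infty f^\alpha(v)g^{1-\alpha}(v)\,dv}$,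 $x>0$. All integrals are assumed to exist, with normalizing integrals finite and positive. *)

(* Defs.v *)
From HB Require Import structures.
From mathcomp Require Import all_boot all_order all_algebra.
From mathcomp Require Import all_classical all_reals all_analysis.

Set Implicit Arguments.
Unset Strict Implicit.
Unset Printing Implicit Defensive.

Import Order.TTheory GRing.Theory Num.Theory.
Import numFieldNormedType.Exports.

Local Open Scope classical_set_scope.
Local Open Scope ring_scope.
Local Open Scope ereal_scope.

Definition has_pdf {d : measure_display} {T : measurableType d} {R : realType}
    (P : probability T R) (X : {RV P >-> R}) (f : R -> R) : Prop :=
  [/\ measurable_fun setT f,
      (forall x : R, (0 <= f x)%R) &
      (forall A : set R, measurable A ->
         P (X @^-1` A) = \int[lebesgue_measure]_(x in A) (f x)%:E)].

(* Each random variable carries its own probability space: the functionals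
   below depend only on densities, so no joint law is involved. *)
Record ac_rv (R : realType) := AcRV {
  ac_disp : measure_display;
  ac_space : measurableType ac_disp;
  ac_prob : probability ac_space R;
  ac_var : {RV ac_prob >-> R};
  ac_ge0 : {ae ac_prob, forall t, (0 <= ac_var t)%R};
  pdf : R -> R;
  pdfP : has_pdf ac_var pdf }.

Section functionals.
Context {R : realType}.
Implicit Types (X Y Z : ac_rv R) (w : R -> R) (a b : R).

Definition info_gen b X : \bar R :=
  \int[lebesgue_measure]_(u in `[0%R, +oo[) (pdf X u `^ b)%:E.

Definition weighted_info_gen w b X : \bar R :=
  \int[lebesgue_measure]_(u in `[0%R, +oo[) (w u * pdf X u `^ b)%:E.

(* [0 `^ r] is [1] for [r = 0] and [0] for every other [r], negative ones
   included.  Hence for [1 < a] the integrand is [0] wherever [pdf Y] vanishes: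
   the usual convention where [pdf X] vanishes as well, and an arbitrary value
   at the points, where the textbook expression is undefined, with
   [pdf Y x = 0 < pdf X x]. *)
Definition rel_info_gen a X Y : \bar R :=
  \int[lebesgue_measure]_(x in `[0%R, +oo[)
    (pdf X x `^ a * pdf Y x `^ (1 - a))%:E.

Definition weighted_rel_info_gen w a X Y : \bar R :=
  \int[lebesgue_measure]_(x in `[0%R, +oo[)
    (w x * (pdf X x `^ a * pdf Y x `^ (1 - a)))%:E.

Definition escort_pdf b X (u : R) : R :=
  if (0 < u)%R then (pdf X u `^ b / fine (info_gen b X))%R else 0%R.

Definition gen_escort_pdf a X Y (x : R) : R :=
  if (0 < x)%R
  then (pdf X x `^ a * pdf Y x `^ (1 - a) / fine (rel_info_gen a X Y))%R
  else 0%R.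

(* Being an escort variable is a condition on the law of [Z] only, so [pdf Z]
   may be any version of the escort density. *)
Definition is_escort b X Z : Prop := has_pdf (ac_var Z) (escort_pdf b X).

Definition is_gen_escort a X Y Z : Prop :=
  has_pdf (ac_var Z) (gen_escort_pdf a X Y).

End functionals.

(* Main.v *)
Require Import Defs.
From HB Require Import structures.
From mathcomp Require Import all_boot all_order all_algebra.
From mathcomp Require Import all_classical all_reals all_analysis.
From mathcomp Require Import measurable_realfun ring.
Import Order.TTheory GRing.Theory Num.Theory.
Import numFieldNormedType.Exports.
Local Open Scope classical_set_scope.
Local Open Scope ring_scope.
Local Open Scope ereal_scope.

(** Densities of the same law agree almost everywhere, so the densities of the
    three escort variables may be replaced by their explicit formulas; the two
    integrands are then proportional, pointwise on [0, +oo[. *)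

(** Both integrals over any measurable set equal the same probability, and total mass 1 makes [f]
    integrable, which forces equality outside a null set. *)
Lemma has_pdf_ae_unique {d : measure_display} {T : measurableType d}
    {R : realType} (P : probability T R) (Z : {RV P >-> R}) (f g : R -> R) :
  has_pdf Z f -> has_pdf Z g ->
  ae_eq lebesgue_measure setT f g.
Proof.
move=> [mf f0 Pf] [mg g0 Pg].
have : ae_eq lebesgue_measure setT (EFin \o f) (EFin \o g).
  apply: integral_ae_eq => //.
  - apply/integrableP; split; first exact/measurable_EFinP.
    under eq_integral do rewrite /= ger0_norm//.
    by rewrite -Pf// preimage_setT probability_setT ltry.
  - exact/measurable_EFinP.
  - by move=> E _ mE; rewrite -Pf// Pg.
by apply: filterS => x /[apply] -[].
Qed.

Lemma powRV {R : realType} (x r : R) :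
  (0 <= x)%R -> (x^-1 `^ r = (x `^ r)^-1)%R.
Proof. by move=> x0; rewrite -powR_inv1// -powRrM mulN1r powRN. Qed.

(** Exponents [a] and [b] commute under iterated powers, and the powers of [I] and [J] cancel. Only
    the constants are inverted, so [p] and [q] may vanish whatever the sign of [1 - a]. *)
Lemma powR_escort {R : realType} (p q I J K a b : R) :
  (0 <= p)%R -> (0 <= q)%R -> (0 < I)%R -> (0 < J)%R -> (0 < K)%R ->
  ((p `^ a * q `^ (1 - a) / K) `^ b =
   I `^ a * J `^ (1 - a) / K `^ b *
   ((p `^ b / I) `^ a * (q `^ b / J) `^ (1 - a)))%R.
Proof.
move=> p0 q0 I0 J0 K0.
rewrite !powRM ?mulr_ge0 ?powR_ge0 ?invr_ge0 ?(ltW I0) ?(ltW J0) ?(ltW K0)//.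
rewrite !powRV ?ltW// (powRAC p b a) (powRAC q b (1 - a)).
by field; rewrite !gt_eqF ?powR_gt0.
Qed.

Theorem theorem4p2 (R : realType) (X Y : ac_rv R) (w : R -> R) (a b : R)
    (Xstar Xe Ye : ac_rv R)
    (mw : measurable_fun (`[0%R, +oo[ : set R) w)
    (w_ge0 : forall x : R, (0 <= x)%R -> (0 <= w x)%R)
    (a_gt0 : (0 < a)%R) (b_ge1 : (1 <= b)%R)
    (IX : 0 < info_gen b X < +oo)
    (IY : 0 < info_gen b Y < +oo)
    (RXY : 0 < rel_info_gen a X Y < +oo)
    (hXstar : is_gen_escort a X Y Xstar)
    (hXe : is_escort b X Xe)
    (hYe : is_escort b Y Ye) :
  weighted_info_gen w b Xstar =
    (info_gen b X `^ a * info_gen b Y `^ (1 - a) / rel_info_gen a X Y `^ b)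
    * weighted_rel_info_gen w a Xe Ye.
Proof.
have eX := has_pdf_ae_unique _ _ _ _ (pdfP Xe) hXe.
have eY := has_pdf_ae_unique _ _ _ _ (pdfP Ye) hYe.
have eS := has_pdf_ae_unique _ _ _ _ (pdfP Xstar) hXstar.
have [_ pX0 _] := pdfP X; have [_ pY0 _] := pdfP Y.
have [mXe Xe0 _] := pdfP Xe; have [mYe Ye0 _] := pdfP Ye.
have [mS S0 _] := pdfP Xstar.
have mpow (f : R -> R) (r : R) : measurable_fun setT f ->
    measurable_fun (`[0%R, +oo[ : set R) (fun x => f x `^ r)%R.
  move=> mf; apply: measurable_funTS.
  exact: (measurableT_comp (measurable_powR r)).
move: eX eY eS; rewrite /escort_pdf /gen_escort_pdf.
(* The bounds leave only positive reals [I], [J], [K] for the three normalizing integrals, so [fine]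
   and the extended powers reduce to real ones. *)
case: (info_gen b X) IX => [I| |] /andP[] //; rewrite lte_fin => I0 _.
case: (info_gen b Y) IY => [J| |] /andP[] //; rewrite lte_fin => J0 _.
case: (rel_info_gen a X Y) RXY => [K| |] /andP[] //; rewrite lte_fin => K0 _.
move=> /= eX eY eS.
rewrite inver gt_eqF ?powR_gt0// -!EFinM.
(* The constant goes under the integral; nonnegativity suffices for this, so the weighted integrals
   may be infinite. *)
rewrite /weighted_rel_info_gen -ge0_integralZl_EFin//; first last.
- by rewrite !mulr_ge0 ?invr_ge0 ?powR_ge0.
- apply/measurable_EFinP; apply: measurable_funM => //.
  by apply: measurable_funM; exact: mpow.
- move=> x /=; rewrite in_itv/= andbT => x0.
  by rewrite lee_fin !mulr_ge0 ?powR_ge0 ?w_ge0.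
apply: ae_eq_integral => //.
- by apply/measurable_EFinP; apply: measurable_funM => //; exact: mpow.
- apply/measurable_EFinP; apply: measurable_funM => //.
  apply: measurable_funM => //.
  by apply: measurable_funM; exact: mpow.
move: eX eY eS; apply: filterS3 => x /(_ Logic.I) eX /(_ Logic.I) eY /(_ Logic.I) eS /=.
rewrite in_itv/= andbT eX eY eS => x0; rewrite -EFinM; congr EFin.
case: ifPn => [xp|_]; last first.
  (* At x = 0 both escort formulas take the junk value 0. *)
  have b_gt0 : (0 < b)%R by exact: lt_le_trans b_ge1.
  (* On the right the factor with exponent [a] is what vanishes: the one with exponent [1 - a]
     equals 1 when [a] is 1. *)
  rewrite (@powR0 _ b) ?gt_eqF// (@powR0 _ a) ?gt_eqF//.
  by rewrite mul0r !mulr0.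
by rewrite (powR_escort _ _ I J)// mulrCA.
Qed.
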